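(* Let $\mathcal V$ be a variety of algebras and let $\mathcal C$ be a lattice class of recognizable sets for $\mathcal V$. Then $\mathcal C$ is closed under inverse images of morphisms if and only if it is given by some class of equations for $\mathcal V$ which is closed under substitution.
   Context: $\mathcal V$ is an equational class of algebras of a fixed (finitary) type $\tau$; for a finite set (alphabet) $A$, $F_{\mathcal V}(A)$ is the free $\mathcal V$-algebra on $A$. For an algebra $G$ of type $\tau$, $L\subseteq G$ is recognizable if $L=\varphi^{-1}(P)$ for some homomorphism $\varphi:G\to F$ into a finite algebra $F$ of type $\tau$ and some $P\subseteq F$; $\mathrm{Rec}(G)$ is the Boolean algebra of recognizable subsets of $G$. The profinite completion $\widehat{G}$ is the inverse limit, as a topological algebra, of the finite discrete algebras $G/\theta$, $\theta$ ranging over the congruences of $G$ of finite index. A point $x=(x_\theta)_\theta\in\widehat G$ is identified with the prime filter $F_x$ of $\mathrm{Rec}(G)$ such that, for $L=q_\theta^{-1}(P)$ with $q_\theta:G\to G/\theta$ the quotient map and $P\subseteq G/\theta$, $L\in F_x\iff x_\theta\in P$. For $x,y\in\widehat G$, $L\in \mathrm{Rec}(G)$ satisfies $x\to y$ iff ($L\in F_y$ implies $L\in F_x$). A class of recognizable sets for $\mathcal V$ is an assignment $A\mapsto\mathcal C(A)\subseteq\mathrm{Rec}(F_{\mathcal V}(A))$, for each finite alphabet $A$; it is a lattice class if each $\mathcal C(A)$ is a bounded sublattice of $\mathrm{Rec}(F_{\mathcal V}(A))$. A class of equations for $\mathcal V$ is an assignment $A\mapsto\Sigma(A)\subseteq\widehat{F_{\mathcal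 V}(A)}\times\widehat{F_{\mathcal V}(A)}$, for each finite alphabet $A$, where a pair $(x,y)$ is written $x\to y$. $\mathcal C$ is given by $\Sigma$ if for each finite alphabet $A$, $\mathcal C(A)$ is the set of all $L\in\mathrm{Rec}(F_{\mathcal V}(A))$ satisfying every $x\to y$ in $\Sigma(A)$. For a homomorphism $\sigma:F_{\mathcal V}(A)\to F_{\mathcal V}(B)$, the map $L\mapsto\sigma^{-1}(L)$ is a Boolean algebra homomorphism $\mathrm{Rec}(F_{\mathcal V}(B))\to\mathrm{Rec}(F_{\mathcal V}(A))$; its Stone dual is the continuous map $\widehat\sigma:\widehat{F_{\mathcal V}(A)}\to\widehat{F_{\mathcal V}(B)}$ (the unique continuous extension of $\sigma$), characterised by $L\in F_{\widehat\sigma(x)}\iff\sigma^{-1}(L)\in F_x$. $\mathcal C$ is closed under inverse images of morphisms if, for all finite alphabets $A,B$ and every homomorphism $\sigma:F_{\mathcal V}(A)\to F_{\mathcal V}(B)$, $L\in\mathcal C(B)$ implies $\sigma^{-1}(L)\in\mathcal C(A)$. $\Sigma$ is closed under substitution if, for all such $A,B,\sigma$, $x\to y\in\Sigma(A)$ implies $\widehat\sigma(x)\to\widehat\sigma(y)\in\Sigma(B)$. *)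

(* Defs.v *)
From HB Require Import structures.
From mathcomp Require Import all_boot.
From mathcomp Require Import all_classical.

Set Implicit Arguments.
Unset Strict Implicit.
Unset Printing Implicit Defensive.

Local Open Scope classical_set_scope.
Local Open Scope quotient_scope.

(* Arbitrary set of operation symbols, each of finite arity. *)
Record signature := Signature { op :> Type; arity : op -> nat }.

(* The carrier of an algebra may be empty (if there are no constants). *)
Record algebra (tau : signature) := Algebra {
  carrier :> Type;
  interp : forall o : tau, ('I_(arity o) -> carrier) -> carrier }.
Arguments interp {tau} a o _.

Record hom (tau : signature) (G H : algebra tau) := Hom {
  hom_fun :> G -> H;
  homP : forall (o : tau) (a : 'I_(arity o) -> G),
    hom_fun (interp G o a) = interp H o (fun i => hom_fun (a i)) }.

Record congruence (tau : signature) (G : algebra tau) := Congruence {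
  cong_rel :> equiv_rel {classic G};
  cong_compat : forall (o : tau) (a b : 'I_(arity o) -> G),
    (forall i, cong_rel (a i) (b i)) ->
    cong_rel (interp G o a) (interp G o b) }.

Section Quotient.
Variables (tau : signature) (G : algebra tau) (theta : congruence G).

(* By compatibility, the choice of representatives is irrelevant:
   see [quot_map_interp]. *)
Definition quot_algebra : algebra tau :=
  @Algebra tau {eq_quot theta}
    (fun o c => \pi_{eq_quot theta} (interp G o (fun i => repr (c i)))).

Definition quot_map (a : G) : quot_algebra := \pi_{eq_quot theta} a.

Lemma quot_mapP (a b : G) : quot_map a = quot_map b <-> theta a b.
Proof. by split=> [/eqmodP|/eqmodP]. Qed.

Lemma quot_map_surj (c : quot_algebra) : exists a, quot_map a = c.
Proof. by exists (repr (c : {eq_quot theta})); rewrite /quot_map reprK. Qed.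

Lemma quot_map_interp (o : tau) (a : 'I_(arity o) -> G) :
  quot_map (interp G o a) = interp quot_algebra o (fun i => quot_map (a i)).
Proof.
apply/quot_mapP/cong_compat => i; apply/quot_mapP.
by rewrite /quot_map reprK.
Qed.

Definition quot_hom : hom G quot_algebra := Hom quot_map_interp.

End Quotient.

Section Terms.
Variable tau : signature.

Inductive term (X : Type) : Type :=
| Var of X
| App (o : tau) of 'I_(arity o) -> term X.

Definition term_algebra (X : Type) : algebra tau := @Algebra tau (term X) (@App X).

Fixpoint eval (X : Type) (B : algebra tau) (v : X -> B) (t : term X) : B :=
  match t with
  | Var x => v x
  | App o a => interp B o (fun i => eval v (a i))
  end.

Definition satisfies_identity (X : Type) (B : algebra tau) (s t : term X) : Prop :=
  forall v : X -> B, eval v s = eval v t.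

Definition equational_class (V : algebra tau -> Prop) : Prop :=
  exists E : set (term nat * term nat),
    forall B, V B <-> forall s t, E (s, t) -> satisfies_identity B s t.

End Terms.

Section FreeAlgebra.
Variables (tau : signature) (V : algebra tau -> Prop) (A : Type).

Definition valid_identity (s t : {classic term tau A}) : bool :=
  `[< forall B, V B -> satisfies_identity B s t >].

Lemma valid_identity_equiv : equiv_class_of valid_identity.
Proof.
split.
- by move=> s; apply/asboolP.
- by move=> s t; apply/idP/idP => /asboolP h; apply/asboolP => B VB v;
    rewrite h.
- move=> t s u /asboolP h /asboolP k; apply/asboolP => B VB v.
  by rewrite h // k.
Qed.

Lemma valid_identity_compat (o : tau) (a b : 'I_(arity o) -> term tau A) :
  (forall i, valid_identity (a i) (b i)) ->
  valid_identity (App a) (App b).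
Proof.
move=> h; apply/asboolP => B VB v /=; congr (interp B o _).
by apply/funext => i; move/asboolP: (h i); exact.
Qed.

Definition valid_congruence : congruence (term_algebra tau A) :=
  @Congruence tau (term_algebra tau A)
    (EquivRelPack valid_identity_equiv) valid_identity_compat.

(* The terms over A modulo the identities valid in V; this is the free
   V-algebra on A by [free_algebra_mem], [free_algebra_lift] and
   [free_algebra_lift_unique]. *)
Definition free_algebra : algebra tau := quot_algebra valid_congruence.

Definition free_gen (a : A) : free_algebra := quot_map valid_congruence (Var tau a).

End FreeAlgebra.

Section FreeAlgebraTheory.
Variables (tau : signature) (V : algebra tau -> Prop) (A : Type).

Lemma eval_quot_map (X : Type) (w : X -> term tau A) (t : term tau X) :
  eval (fun x => quot_map (valid_congruence V A) (w x)) t =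
  quot_map (valid_congruence V A) (eval (w : X -> term_algebra tau A) t).
Proof.
elim: t => [//|o a IH].
rewrite (quot_map_interp (valid_congruence V A)
  (fun i => eval (w : X -> term_algebra tau A) (a i))).
by congr (interp _ o _); apply/funext => i; exact: IH.
Qed.

Lemma eval_subst (X : Type) (w : X -> term tau A) (B : algebra tau)
    (v : A -> B) (t : term tau X) :
  eval v (eval (w : X -> term_algebra tau A) t) = eval (fun x => eval v (w x)) t.
Proof.
elim: t => [//|o a IH] /=.
by congr (interp _ o _); apply/funext => i; exact: IH.
Qed.

Lemma free_algebra_mem : equational_class V -> V (free_algebra V A).
Proof.
move=> [E VE]; apply/VE => s t Est v.
have [w ->] : exists w : nat -> term tau A,
    v = fun x => quot_map (valid_congruence V A) (w x).
  exists (fun x => repr (v x : {eq_quot (valid_congruence V A)})).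
  by apply/funext => x; rewrite /quot_map reprK.
rewrite !eval_quot_map; apply/quot_mapP/asboolP => B VB u.
by rewrite !eval_subst; apply: (VE B).1.
Qed.

Lemma free_algebra_lift (B : algebra tau) (v : A -> B) : V B ->
  exists f : hom (free_algebra V A) B, forall a, f (free_gen V a) = v a.
Proof.
move=> VB.
pose f (c : free_algebra V A) : B :=
  eval v (repr (c : {eq_quot (valid_congruence V A)}) : term tau A).
have fE t : f (quot_map (valid_congruence V A) t) = eval v t.
  have /quot_mapP/asboolP : quot_map (valid_congruence V A)
      (repr (quot_map (valid_congruence V A) t : {eq_quot (valid_congruence V A)}))
      = quot_map (valid_congruence V A) t by rewrite /quot_map reprK.
  exact.
have fhom (o : tau) (a : 'I_(arity o) -> free_algebra V A) :
    f (interp _ o a) = interp B o (fun i => f (a i)).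
  exact: (fE (App (fun i => repr (a i : {eq_quot (valid_congruence V A)})))).
by exists (Hom fhom) => a; exact: fE.
Qed.

Lemma free_algebra_lift_unique (B : algebra tau) (f g : hom (free_algebra V A) B) :
  (forall a, f (free_gen V a) = g (free_gen V a)) -> forall c, f c = g c.
Proof.
move=> fg c; have [t <-] := quot_map_surj c.
elim: t => [a|o a IH]; first exact: fg.
rewrite (quot_map_interp (valid_congruence V A)) !homP.
by congr (interp _ o _); apply/funext => i; exact: IH.
Qed.

End FreeAlgebraTheory.

Section Profinite.
Variables (tau : signature) (G : algebra tau).

Definition recognizable : set (set G) := [set L |
  exists (F : algebra tau) (phi : hom G F) (P : set F),
    finite_set [set: F] /\ L = phi @^-1` P].

Record fin_congruence := FinCongruence {
  fin_cong :> congruence G;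
  fin_congP : finite_set [set: quot_algebra fin_cong] }.

(* Threads of the inverse system of the finite quotients of G: when theta is
   contained in theta', the connecting map sends the class of a modulo theta
   to the class of a modulo theta'. *)
Record completion := Completion {
  point :> forall theta : fin_congruence, quot_algebra theta;
  pointP : forall theta theta' : fin_congruence,
    (forall a b, theta a b -> theta' a b) ->
    forall a, point theta = quot_map theta a -> point theta' = quot_map theta' a }.

(* The prime filter F_x; independent of the presentation of L by [point_filterP]. *)
Definition point_filter (x : completion) : set (set G) := [set L |
  exists (theta : fin_congruence) (P : set (quot_algebra theta)),
    L = quot_map theta @^-1` P /\ P (x theta)].

Definition satisfies (L : set G) (x y : completion) : Prop :=
  point_filter y L -> point_filter x L.

End Profinite.

Section Kernel.
Variables (tau : signature) (G H : algebra tau) (f : hom G H) (theta : congruence H).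

Definition pull_rel (a b : {classic G}) : bool := theta (f a) (f b).

Lemma pull_rel_equiv : equiv_class_of pull_rel.
Proof.
split=> [a|a b|b a c]; rewrite /pull_rel.
- exact: equiv_refl.
- exact: equiv_sym.
- exact: equiv_trans.
Qed.

Lemma pull_rel_compat (o : tau) (a b : 'I_(arity o) -> G) :
  (forall i, pull_rel (a i) (b i)) -> pull_rel (interp G o a) (interp G o b).
Proof. by move=> h; rewrite /pull_rel !homP; apply: cong_compat. Qed.

Definition pull_congruence : congruence G :=
  @Congruence tau G (EquivRelPack pull_rel_equiv) pull_rel_compat.

Lemma pull_congruence_finite : finite_set [set: quot_algebra theta] ->
  finite_set [set: quot_algebra pull_congruence].
Proof.
move=> fin.
pose g (c : {classic quot_algebra pull_congruence}) : {classic quot_algebra theta} :=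
  quot_map theta (f (repr (c : {eq_quot pull_congruence}))).
apply: (@finite_preimage {classic quot_algebra pull_congruence}
  {classic quot_algebra theta} setT g) => //.
move=> c d _ _ /quot_mapP cd.
rewrite -[c](@reprK _ {eq_quot pull_congruence}).
by rewrite -[d](@reprK _ {eq_quot pull_congruence}); apply/quot_mapP.
Qed.

End Kernel.

Section ProfiniteTheory.
Variables (tau : signature) (G : algebra tau).

Definition meet_rel (theta theta' : congruence G) (a b : {classic G}) : bool :=
  theta a b && theta' a b.

Lemma meet_rel_equiv (theta theta' : congruence G) :
  equiv_class_of (meet_rel theta theta').
Proof.
split=> [a|a b|b a c]; rewrite /meet_rel.
- by rewrite !equiv_refl.
- by rewrite (equiv_sym theta) (equiv_sym theta').
- move=> /andP[ab ab'] /andP[bc bc'].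
  by rewrite (equiv_trans ab bc) (equiv_trans ab' bc').
Qed.

Lemma meet_rel_compat (theta theta' : congruence G) (o : tau)
    (a b : 'I_(arity o) -> G) :
  (forall i, meet_rel theta theta' (a i) (b i)) ->
  meet_rel theta theta' (interp G o a) (interp G o b).
Proof.
move=> h; apply/andP.
by split; apply: cong_compat => i; case/andP: (h i).
Qed.

Definition meet_congruence (theta theta' : congruence G) : congruence G :=
  @Congruence tau G (EquivRelPack (meet_rel_equiv theta theta'))
    (@meet_rel_compat theta theta').

Lemma meet_congruence_finite (theta theta' : fin_congruence G) :
  finite_set [set: quot_algebra (meet_congruence theta theta')].
Proof.
set m := meet_congruence theta theta'.
pose r (c : quot_algebra m) : G := repr (c : {eq_quot m}).
pose g (c : {classic quot_algebra m}) :
    {classic quot_algebra theta} * {classic quot_algebra theta'} :=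
  (quot_map theta (r c), quot_map theta' (r c)).
apply: (@finite_preimage {classic quot_algebra m} _ setT g).
  move=> c d _ _ [/quot_mapP cd /quot_mapP cd'].
  rewrite -[c](@reprK _ {eq_quot m}) -[d](@reprK _ {eq_quot m}).
  by apply/quot_mapP/andP.
rewrite -setXTT; apply: finite_setX; exact: fin_congP.
Qed.

Definition fin_meet (theta theta' : fin_congruence G) : fin_congruence G :=
  FinCongruence (meet_congruence_finite theta theta').

Lemma point_common (x : completion G) (theta theta' : fin_congruence G) :
  exists a, x theta = quot_map theta a /\ x theta' = quot_map theta' a.
Proof.
have [a /esym xa] := quot_map_surj (x (fin_meet theta theta')).
by exists a; split; apply: (pointP _ xa) => b c /andP[].
Qed.

Lemma point_filterP (x : completion G) (theta : fin_congruence G)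
    (P : set (quot_algebra theta)) :
  point_filter x (quot_map theta @^-1` P) <-> P (x theta).
Proof.
split=> [[theta' [P' [PP' Px]]]|Px]; last by exists theta, P.
have [a [xa xa']] := point_common x theta theta'.
have : (quot_map theta @^-1` P) a by rewrite PP' /preimage /= -xa'.
by rewrite /preimage /= -xa.
Qed.

Lemma recognizableP (L : set G) : recognizable L <->
  exists (theta : fin_congruence G) (P : set (quot_algebra theta)),
    L = quot_map theta @^-1` P.
Proof.
split=> [[F [phi [P [finF ->]]]]|[theta [P ->]]]; last first.
  exists (quot_algebra theta), (quot_hom theta), P.
  by split=> //; exact: fin_congP.
pose eqF (a b : {classic F}) : bool := a == b.
have eqF_equiv : equiv_class_of eqF.
  split=> [a|a b|b a c]; rewrite /eqF.
  - exact: eqxx.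
  - exact: eq_sym.
  - by move=> /eqP-> /eqP->.
have eqF_compat (o : tau) (a b : 'I_(arity o) -> F) :
    (forall i, eqF (a i) (b i)) -> eqF (interp F o a) (interp F o b).
  move=> h; apply/eqP; congr (interp F o _); apply/funext => i.
  exact: eqP (h i).
pose d : congruence F := @Congruence tau F (EquivRelPack eqF_equiv) eqF_compat.
have find : finite_set [set: quot_algebra d].
  pose g : {classic F} -> {classic quot_algebra d} := quot_map d.
  have -> : [set: quot_algebra d] = g @` [set: {classic F}].
    apply/seteqP; split=> // c _.
    by have [a <-] := quot_map_surj c; exists a.
  exact: finite_image.
exists (FinCongruence (pull_congruence_finite phi find)).
exists [set c | exists2 a, quot_map _ a = c & P (phi a)].
apply/seteqP; split=> a /=; first by exists a.
case=> b ba; by have /eqP <- := (quot_mapP (pull_congruence phi d) b a).1 ba.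
Qed.

Lemma point_filter_inj (x y : completion G) :
  (forall L, recognizable L -> point_filter x L <-> point_filter y L) -> x = y.
Proof.
move=> h.
have E : point x = point y.
  apply: functional_extensionality_dep => theta.
  pose L := quot_map theta @^-1` [set c | c = x theta].
  have recL : recognizable L.
    by apply/recognizableP; exists theta, [set c | c = x theta].
  apply/esym; apply: (point_filterP y [set c | c = x theta]).1.
  by apply: (h _ recL).1; apply/point_filterP.
case: x y E {h} => [p pP] [q qP] /= E; case: q / E qP => qP.
by congr Completion; exact: Prop_irrelevance.
Qed.

End ProfiniteTheory.

Section StoneDual.
Variables (tau : signature) (G H : algebra tau) (sigma : hom G H).

Definition fin_pull (theta : fin_congruence H) : fin_congruence G :=
  FinCongruence (pull_congruence_finite sigma (@fin_congP _ _ theta)).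

Lemma fin_pullP (theta : fin_congruence H) (a b : G) :
  quot_map (fin_pull theta) a = quot_map (fin_pull theta) b <->
  quot_map theta (sigma a) = quot_map theta (sigma b).
Proof. by split=> h; apply/quot_mapP; exact: (quot_mapP _ _ _).1 h. Qed.

Lemma recognizable_preimage (L : set H) :
  recognizable L -> recognizable (sigma @^-1` L).
Proof.
move=> /recognizableP[theta [P ->]]; apply/recognizableP.
exists (fin_pull theta).
exists [set c | exists2 a, quot_map _ a = c & P (quot_map theta (sigma a))].
apply/seteqP; split=> a /=; first by exists a.
by case=> b /fin_pullP ->.
Qed.

Lemma stone_dual_exists (x : completion G) : exists y : completion H,
  forall L, recognizable L -> point_filter y L <-> point_filter x (sigma @^-1` L).
Proof.
pose p (theta : fin_congruence H) : quot_algebra theta :=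
  quot_map theta (sigma (repr (x (fin_pull theta) : {eq_quot (fin_pull theta)}))).
have pE theta a : x (fin_pull theta) = quot_map (fin_pull theta) a ->
    p theta = quot_map theta (sigma a).
  by move=> xa; apply/fin_pullP; rewrite -xa /quot_map reprK.
have pP (theta theta' : fin_congruence H) : (forall a b, theta a b -> theta' a b) ->
    forall a, p theta = quot_map theta a -> p theta' = quot_map theta' a.
  move=> sub a.
  have [b /esym xb] := quot_map_surj (x (fin_pull theta)).
  rewrite (pE _ _ xb) => /quot_mapP ba.
  have /pE -> : x (fin_pull theta') = quot_map (fin_pull theta') b.
    by apply: (pointP _ xb) => c d; exact: sub.
  by apply/quot_mapP; exact: sub.
exists (Completion pP) => L /recognizableP[theta [P ->]].
rewrite point_filterP /=.
have [b xb] := quot_map_surj (x (fin_pull theta)).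
rewrite (pE _ _ (esym xb)).
have -> : sigma @^-1` (quot_map theta @^-1` P) = quot_map (fin_pull theta) @^-1`
    [set c | exists2 a, quot_map _ a = c & P (quot_map theta (sigma a))].
  apply/seteqP; split=> a /=; first by exists a.
  by case=> c /fin_pullP ->.
rewrite point_filterP -xb; split=> [Pb|]; first by exists b.
by case=> c /fin_pullP ->.
Qed.

Definition stone_dual (x : completion G) : completion H :=
  projT1 (cid (stone_dual_exists x)).

Lemma stone_dualP (x : completion G) (L : set H) : recognizable L ->
  point_filter (stone_dual x) L <-> point_filter x (sigma @^-1` L).
Proof. exact: (projT2 (cid (stone_dual_exists x))). Qed.

End StoneDual.

Section Classes.
Variables (tau : signature) (V : algebra tau -> Prop).

Record rec_class := RecClass {
  rec_sets :> forall A : finType, set (set (free_algebra V A));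
  rec_setsP : forall A : finType, @rec_sets A `<=` @recognizable tau (free_algebra V A) }.
Arguments rec_sets _ _ _ : clear implicits.

Definition lattice_class (C : rec_class) : Prop :=
  forall A : finType,
    [/\ C A set0, C A setT,
        forall L M, C A L -> C A M -> C A (L `&` M) &
        forall L M, C A L -> C A M -> C A (L `|` M)].

(* The pair (x, y) stands for the equation x -> y. *)
Definition equation_class : Type :=
  forall A : finType, set (completion (free_algebra V A) * completion (free_algebra V A)).

Definition given_by (C : rec_class) (Sigma : equation_class) : Prop :=
  forall A : finType, C A = [set L | recognizable L /\
    forall x y, Sigma A (x, y) -> satisfies L x y].

Definition closed_under_inverse_images (C : rec_class) : Prop :=
  forall (A B : finType) (sigma : hom (free_algebra V A) (free_algebra V B))
    (L : set (free_algebra V B)), C B L -> C A (sigma @^-1` L).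

Definition closed_under_substitution (Sigma : equation_class) : Prop :=
  forall (A B : finType) (sigma : hom (free_algebra V A) (free_algebra V B))
    (x y : completion (free_algebra V A)),
    Sigma A (x, y) -> Sigma B (stone_dual sigma x, stone_dual sigma y).

End Classes.

Arguments rec_sets {tau V} _ _ _.

(* Main.v *)
Require Import Defs.
From mathcomp Require Import all_boot all_classical.

(** The equations to take are all those that [C] satisfies, [Sigma A] being the
    set of pairs [(x, y)] such that every member of [C A] satisfies [x -> y].
    By the defining property of the Stone dual, a set [M] satisfies
    [sigma^ x -> sigma^ y] exactly when [sigma @^-1` M] satisfies [x -> y]
    ([satisfies_stone_dual]).  This one equivalence carries both closure
    properties: it turns closure of [C] under inverse images into closure of
    [Sigma] under substitution, and conversely, if [C] is given by a [Sigma]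
    closed under substitution, it shows that inverse images of members of [C]
    satisfy [Sigma].

    What remains is that a bounded sublattice [D] of the recognizable sets is
    determined by the equations it satisfies
    ([sublattice_determined_by_equations]), which is the duality between
    sublattices and quotients of Priestley spaces.  Suppose that [L] is
    recognizable and not in [D].  No [M] in [D] with [M `<=` L] is all of [L],
    and such [M] are closed under union, so some ultrafilter [U] contains every
    [L `\` M].  Then no member of [D] that belongs to [U] is included in [L];
    these members are closed under intersection, so some ultrafilter [W]
    contains all of them and avoids [L].  An ultrafilter on [G] converges to a
    point of the profinite completion whose prime filter is the trace of the
    ultrafilter on recognizable sets ([ultrafilter_point]), because every
    quotient involved is finite.  With [x] and [y] the limits of [W] and [U],
    the equation [x -> y] holds in [D] and fails for [L]. *)

Local Open Scope classical_set_scope.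

Lemma ultrafilter_of_base {T : Type} (B : set (set T)) :
  B !=set0 ->
  (forall X Y, B X -> B Y -> exists2 Z, B Z & Z `<=` X `&` Y) ->
  (forall X, B X -> X !=set0) ->
  exists2 U : set_system T, UltraFilter U & B `<=` U.
Proof.
move=> B0 BI Bn0.
have FB : Filter (filter_from B id) by exact: filter_from_filter.
have [U [UU sBU]] := ultraFilterLemma (filter_from_proper FB Bn0).
by exists U => // X BX; apply: sBU; exists X.
Qed.

(** If no fibre of [f] were in [U], then the intersection of the finitely many
    complements, which is empty, would be. *)
Lemma ultrafilter_fiber {T : Type} {I : choiceType} (U : set_system T)
    (f : T -> I) :
  UltraFilter U -> finite_set [set: I] -> exists i, U (f @^-1` [set i]).
Proof.
move=> UU /finite_fsetP[E ET]; apply: contrapT => nU.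
have UC i : U (~` (f @^-1` [set i])).
  case: (in_ultra_setVsetC (f @^-1` [set i]) UU) => // Ui.
  by case: nU; exists i.
have [t tC] := filter_ex (filter_bigI (D := E) _ (fun i _ => UC i)).
have : [set: I] (f t) by [].
by rewrite ET => /tC; apply.
Qed.

Lemma ultrafilter_class {tau : signature} {G : algebra tau} (U : set_system G)
    (theta : fin_congruence G) :
  UltraFilter U ->
  exists c : quot_algebra theta, U (quot_map theta @^-1` [set c]).
Proof.
move=> UU; pose f : G -> {classic quot_algebra theta} := quot_map theta.
by have [c] := ultrafilter_fiber U f UU (@fin_congP _ _ theta); exists c.
Qed.

(** The thread picks, in each finite quotient, the one class that belongs to
    the ultrafilter; two members of a filter meet, whence uniqueness and
    compatibility with the connecting maps. *)
Lemma ultrafilter_point {tau : signature} {G : algebra tau} (U : set_system G) :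
  UltraFilter U ->
  exists x : completion G, forall L, recognizable L -> point_filter x L <-> U L.
Proof.
move=> UU.
pose p (theta : fin_congruence G) := projT1 (cid (ultrafilter_class U theta UU)).
have pU (theta : fin_congruence G) : U (quot_map theta @^-1` [set p theta]).
  exact: (projT2 (cid (ultrafilter_class U theta UU))).
have pP (theta theta' : fin_congruence G) :
    (forall a b, theta a b -> theta' a b) ->
    forall a, p theta = quot_map theta a -> p theta' = quot_map theta' a.
  move=> sub a pa.
  have [b [bp bp']] := filter_ex (filterI (pU theta) (pU theta')).
  rewrite -bp'; apply/quot_mapP/sub/quot_mapP.
  by rewrite -pa.
exists (Completion pP) => L /recognizableP[theta [P ->]].
rewrite point_filterP /=; split=> [Pp|UP].
  by apply: filterS (pU theta) => a /= ->.
by have [b [/= <-]] := filter_ex (filterI (pU theta) UP).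
Qed.

Lemma sublattice_determined_by_equations {tau : signature} {G : algebra tau}
    (D : set (set G)) (L : set G) :
  D `<=` recognizable (G := G) ->
  D set0 -> D setT ->
  (forall M N, D M -> D N -> D (M `&` N)) ->
  (forall M N, D M -> D N -> D (M `|` N)) ->
  recognizable L ->
  (forall x y, (forall M, D M -> satisfies M x y) -> satisfies L x y) ->
  D L.
Proof.
move=> Drec D0 DT DI DU recL Leq; apply: contrapT => nDL.
have [||_ [M [DM ML] <-]|U UU sU] :=
    @ultrafilter_of_base _ [set L `\` M | M in [set M | D M /\ M `<=` L]].
- by exists (L `\` set0), set0 => //; split=> //; exact: sub0set.
- move=> _ _ [M [DM ML] <-] [N [DN NL] <-].
  exists (L `\` (M `|` N)).
    by exists (M `|` N) => //; split; [exact: DU|rewrite subUset].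
  by rewrite setDUr.
- apply/set0P/eqP; rewrite setD_eq0 => LM; apply: nDL.
  by have -> : L = M by exact/seteqP.
have UL : U L.
  rewrite -(setD0 L); apply: sU; exists set0 => //.
  by split=> //; exact: sub0set.
have nsub M : D M -> U M -> ~ (M `<=` L).
  move=> DM UM ML; have UD : U (L `\` M) by apply: sU; exists M.
  by have [a [Ma [_]]] := filter_ex (filterI UM UD).
have [||_ [M [DM UM] <-]|W UW sW] :=
    @ultrafilter_of_base _ [set M `\` L | M in [set M | D M /\ U M]].
- by exists (setT `\` L), setT => //; split=> //; exact: filterT.
- move=> _ _ [M [DM UM] <-] [N [DN UN] <-].
  exists ((M `&` N) `\` L).
    by exists (M `&` N) => //; split; [exact: DI|exact: filterI].
  by move=> a [[Ma Na] nLa].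
- apply/set0P/eqP; rewrite setD_eq0; exact: nsub.
have [x xW] := ultrafilter_point W UW.
have [y yU] := ultrafilter_point U UU.
have WL : W L.
  apply/xW => //; apply: (Leq x y); last exact/yU.
  move=> M DM /yU UM; apply/xW; first exact: Drec.
  have WM : W (M `\` L) by apply: sW; exists M => //; split=> //; exact/UM/Drec.
  by apply: filterS WM => a [].
have WT : W (setT `\` L).
  by apply: sW; exists setT => //; split=> //; exact: filterT.
by have [a [La [_]]] := filter_ex (filterI WL WT).
Qed.

Lemma satisfies_stone_dual {tau : signature} {G H : algebra tau}
    (sigma : hom G H) (M : set H) (x y : completion G) :
  recognizable M ->
  satisfies M (stone_dual sigma x) (stone_dual sigma y) <->
  satisfies (sigma @^-1` M) x y.
Proof. by move=> recM; rewrite /satisfies !stone_dualP. Qed.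

Theorem theorem4p15 (tau : signature) (V : algebra tau -> Prop)
    (hV : equational_class V) (C : rec_class V) (hC : lattice_class C) :
  closed_under_inverse_images C <->
  exists Sigma : equation_class V,
    given_by C Sigma /\ closed_under_substitution Sigma.
Proof.
split=> [Cinv|[Sigma [CS Ssub]] A B sigma L].
- exists (fun A => [set p | forall M, rec_sets C A M -> satisfies M p.1 p.2]).
  split=> [A|A B sigma x y Sxy M CM].
  + apply/seteqP; split=> [L CL|L [recL Leq]].
      by split=> [|x y]; [exact: rec_setsP CL|exact].
    have [D0 DT DI DU] := hC A.
    by apply: sublattice_determined_by_equations => //; exact: rec_setsP.
  + apply/satisfies_stone_dual; first exact: rec_setsP CM.
    exact/Sxy/Cinv.
- rewrite !CS => -[recL Leq]; split; first exact: recognizable_preimage.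
  by move=> x y Sxy; apply/satisfies_stone_dual => //; exact/Leq/Ssub.
Qed.
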